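(* Let $p>3$ be a prime and $k\in\{2,4,\ldots,p-3\}$. Then $$\sum_{x=1}^{[p/6]}\frac1{x^k}\equiv6^k\sum_{\substack{x=1\\6\mid x-p}}^{p-1}\frac1{x^k}\equiv\frac{6^k(2^k+1)}{4(2^{k-1}+1)}\left(\frac p3\right)U_{p-1-k}\pmod p$$ and $$\sum_{x=1}^{[p/3]}\frac1{x^k}\equiv3^k\sum_{\substack{x=1\\3\mid x-p}}^{p-1}\frac1{x^k}\equiv\frac{6^k}{4(2^{k-1}+1)}\left(\frac p3\right)U_{p-1-k}\pmod p.$$
   Context: $[x]$ is the greatest integer not exceeding $x$; empty sums are $0$. The sequence $\{U_n\}_{n\ge0}$ is defined by $U_0=1$ and $U_n=-2\sum_{j=1}^{[n/2]}\binom n{2j}U_{n-2j}$ for $n\ge1$. $\left(\frac p3\right)$ is the Legendre symbol: it equals $1$ if $p\equiv1\pmod3$ and $-1$ if $p\equiv2\pmod3$. Congruences modulo $p$ are between rational numbers whose denominators are coprime to $p$.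
   Formalization: The second congruence of each chain is stated only when p does not divide 2^{k-1}+1; without this the claim is false, e.g. for p=11, k=6 the sum over x≤[p/3] is 10 while the right side is 1 mod 11. *)

(* Defs.v *)
(* Library: MathComp. *)
From mathcomp Require Import all_boot all_order all_algebra.

Set Implicit Arguments.
Unset Strict Implicit.
Unset Printing Implicit Defensive.

Import Order.TTheory GRing.Theory Num.Theory.

Local Open Scope ring_scope.

(* Course-of-values recursion: U_seq n is the list [U_0; ...; U_n]; the
   defining recurrence of U is recovered in U_0 and U_rec. *)
Fixpoint U_seq (n : nat) : seq int :=
  if n is m.+1 then
    let s := U_seq m in
    rcons s (- 2 * \sum_(1 <= j < (n./2).+1) 'C(n, 2 * j)%:R * s`_(n - 2 * j))
  else [:: 1].

Definition U (n : nat) : int := (U_seq n)`_n.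

Lemma size_U_seq n : size (U_seq n) = n.+1.
Proof. by elim: n => //= n IHn; rewrite size_rcons IHn. Qed.

Lemma nth_U_seq n m : (m <= n)%N -> (U_seq n)`_m = U m.
Proof.
elim: n => [|n IHn]; first by case: m.
rewrite leq_eqVlt => /predU1P[-> //|lt_mn].
by rewrite /= nth_rcons size_U_seq lt_mn IHn.
Qed.

Lemma U_0 : U 0 = 1.
Proof. by []. Qed.

Lemma U_rec n : (0 < n)%N ->
  U n = - 2 * \sum_(1 <= j < (n./2).+1) 'C(n, 2 * j)%:R * U (n - 2 * j).
Proof.
case: n => // n _; rewrite {1}/U [U_seq _]/= nth_rcons size_U_seq ltnn eqxx.
congr (_ * _); apply: eq_big_nat => j /andP[j_gt0 _].
by rewrite nth_U_seq // leq_subLR -[n.+1]add1n leq_add2r muln_gt0.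
Qed.

(* The Legendre symbol (p/3). *)
Definition legendre3 (p : nat) : int :=
  if (p %% 3 == 1)%N then 1 else if (p %% 3 == 2)%N then -1 else 0.

(* Congruence modulo p between rationals with denominators coprime to p.
   numq and denq are taken in lowest terms. *)
Definition ratcong (p : nat) (a b : rat) : Prop :=
  [/\ coprimez p%:Z (denq a), coprimez p%:Z (denq b)
    & (p%:Z %| numq (a - b))%Z].

(* Main.v *)
(* In F_p one has 1/x^k = x^n with n = p-1-k.  The recurrence of U says that
   the umbral polynomial P(y) = (y + U)^n satisfies
   P(y+1) + P(y-1) - P(y) = y^n, so that P(y+6) - P(y) is a signed sum of
   n-th powers.  Telescoping from 1 or -1 up to p, where P(p) = P(0) = U_n and
   P(1) = P(-1) = U_n / 2, gives one linear relation between U_n and the sums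
   A_i of x^n over 0 < x < p, x = i mod 6.  The substitutions x -> p - x and
   x -> 2x and the vanishing of the sum over all x give enough further
   relations to express every A_i through U_n. *)
Require Import Defs.
From mathcomp Require Import all_boot all_order all_algebra.
From mathcomp Require Import zify ring.
From mathcomp Require finfield.
Import Order.TTheory GRing.Theory Num.Theory.
Local Open Scope ring_scope.

Set Implicit Arguments.
Unset Strict Implicit.
Unset Printing Implicit Defensive.

(** * Reindexing over multiples, and the recurrence of [U] in symmetric form *)

Lemma big_dvdn_mul (V : nmodType) (d m : nat) (P : pred nat) (F : nat -> V) :
  (0 < d)%N ->
  \sum_(1 <= x < m.+1 | (d %| x)%N && P x) F x =
  \sum_(1 <= y < (m %/ d).+1 | P (d * y)%N) F (d * y)%N.
Proof.
move=> d_gt0; elim: m => [|m IHm]; first by rewrite div0n !big_geq.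
rewrite big_mkcond big_nat_recr //= -big_mkcond /= IHm divnS //.
have [d_m|_] /= := boolP (d %| m.+1)%N; last by rewrite addr0.
have def_m : (d * (m %/ d).+1 = m.+1)%N.
  by rewrite mulnC -[RHS](divnK d_m) divnS // d_m.
by rewrite [RHS]big_mkcond big_nat_recr //= -big_mkcond def_m.
Qed.

Lemma U_oddE n : odd n -> U n = 0.
Proof.
have [m] := ubnP n; elim: m n => // m IHm n le_nm n_odd.
rewrite U_rec; last by case: n n_odd {le_nm}.
rewrite big_nat_cond big1 ?mulr0 // => j /andP[/andP[j1 j2] _].
rewrite IHm ?mulr0 //; first by lia.
by lia.
Qed.

(** The factor [1 + (-1) ^+ i] is 2 at even [i] and 0 at odd [i]. For positive [m] the term [i = 0]
    gives 2 U_m and the other even terms give - U_m by the recurrence; the extra 1 at [m = 0] comes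
    from 2 U_0 = U_0 + 1. *)
Lemma sum_binU (R : comPzRingType) m :
  \sum_(i < m.+1) 'C(m, i)%:R * (1 + (-1) ^+ i) * (U (m - i))%:~R
  = (U m)%:~R + (m == 0)%N%:R :> R.
Proof.
case: m => [|m].
  by rewrite big_ord1 [U _]U_0 /= expr0 rmorph1 mul1r mulr1.
rewrite addr0 -(big_mkord xpredT
  (fun i => 'C(m.+1, i)%:R * (1 + (-1) ^+ i) * (U (m.+1 - i))%:~R)).
rewrite big_ltn // bin0 subn0 mul1r expr0.
rewrite (bigID (dvdn 2)) /= [X in _ + (_ + X)]big1 => [|i]; last first.
  by rewrite dvdn2 negbK -signr_odd => ->; rewrite subrr mulr0 mul0r.
rewrite (eq_bigl (fun i => (2 %| i)%N && predT i)) => [|i]; last first.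
  by rewrite andbT.
rewrite big_dvdn_mul //.
rewrite [X in X + _](_ : _ = (U m.+1)%:~R + (U m.+1)%:~R); last by ring.
rewrite [X in _ + _ + (X + _)](_ : _ = - (U m.+1)%:~R); first by ring.
rewrite [in RHS]U_rec // divn2 rmorphM rmorph_sum mulr_sumr -sumrN.
apply: eq_bigr => j _; rewrite -signr_odd oddM /=.
rewrite !rmorphM rmorphN /= !rmorph_nat; ring.
Qed.

(** * The umbral functional X^i -> U_i and the polynomials (y + U)^n *)

Definition umbralU (R : comNzRingType) (N : nat) (q : {poly R}) : R :=
  \sum_(i < N) q`_i * (U i)%:~R.

(** Binomial expansion followed by X^i -> U_i. The bound [m < N] ensures that the truncation in
    [umbralU] loses no coefficient, so one [N] serves all powers up to a given degree. *)
Lemma umbralU_XDC (R : comNzRingType) N m (a : R) : (m < N)%N ->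
  umbralU N (('X + a%:P) ^+ m) =
  \sum_(i < m.+1) 'C(m, i)%:R * a ^+ i * (U (m - i))%:~R.
Proof.
move=> lt_mN; rewrite /umbralU exprDn.
under eq_bigr => i _ do rewrite coef_sum mulr_suml.
rewrite exchange_big; apply: eq_bigr => j _ /=.
have lt_mjN : (m - j < N)%N by lia.
rewrite (bigD1 (Ordinal lt_mjN)) //= big1 => [|i ne_i].
  by rewrite coefMn -polyC_exp coefMC coefXn eqxx mul1r addr0 mulr_natl.
rewrite coefMn -polyC_exp coefMC coefXn.
by rewrite (negbTE (ne_i : (i : nat) != (m - j)%N)) mul0r mul0rn mul0r.
Qed.

Lemma umbralU_rec (R : comNzRingType) N m : (m < N)%N ->
  umbralU N (('X + 1%:P) ^+ m) + umbralU N (('X + (-1)%:P) ^+ m)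
  - umbralU N (('X + 0%:P) ^+ m) = (m == 0)%N%:R :> R.
Proof.
move=> lt_mN; rewrite !umbralU_XDC // -big_split /=.
rewrite [X in _ - X]big_ord_recl [X in _ - (_ + X)]big1 => [|i _]; last first.
  by rewrite lift0 exprS mul0r mulr0 mul0r.
rewrite expr0 bin0 subn0 !mul1r addr0; apply/eqP; rewrite subr_eq addrC.
rewrite -sum_binU; apply/eqP/eq_bigr => i _; rewrite expr1n; ring.
Qed.

(* These satisfy the umbral identity P_n(y) = (y + U)^n. *)
Definition appellU (R : comNzRingType) (n : nat) (y : R) : R :=
  umbralU n.+1 (('X + y%:P) ^+ n).

Lemma appellUE (R : comNzRingType) n (y : R) :
  appellU n y = \sum_(i < n.+1) 'C(n, i)%:R * y ^+ i * (U (n - i))%:~R.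
Proof. by rewrite /appellU umbralU_XDC. Qed.

(** Expanding (X + z + y)^n in powers of y isolates the dependence on z, so that [umbralU_rec] can
    be applied termwise with z = 1, -1, 0. *)
Lemma appellU_D (R : comNzRingType) n (y z : R) :
  appellU n (y + z) =
  \sum_(j < n.+1)
     umbralU n.+1 (('X + z%:P) ^+ (n - j)) * y ^+ j * 'C(n, j)%:R.
Proof.
rewrite /appellU [y + z]addrC polyCD addrA exprDn /umbralU.
under eq_bigr => i _ do rewrite coef_sum mulr_suml.
rewrite exchange_big; apply: eq_bigr => j _ /=.
rewrite !mulr_suml; apply: eq_bigr => i _.
rewrite coefMn -polyC_exp coefMC -mulr_natr; ring.
Qed.

Lemma appellU_rec (R : comNzRingType) n (y : R) :
  appellU n (y + 1) + appellU n (y - 1) - appellU n y = y ^+ n.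
Proof.
rewrite -[X in _ - appellU _ X]addr0 !appellU_D -big_split -sumrB /=.
(* By [umbralU_rec] the coefficient of y^j is nonzero only when n - j = 0, so just the last term
   survives. *)
rewrite big_ord_recr big1 => [|j _] /=.
  by rewrite subnn -!mulrDl -!mulrBl umbralU_rec // binn eqxx add0r mul1r mulr1.
have nz_nj : (n - j == 0)%N = false by have := ltn_ord j; lia.
by rewrite -!mulrDl -!mulrBl umbralU_rec ?nz_nj ?mul0r //; lia.
Qed.

Lemma appellU_even (R : comNzRingType) n (y : R) :
  ~~ odd n -> appellU n (- y) = appellU n y.
Proof.
move=> n_even; rewrite !appellUE; apply: eq_bigr => i _.
have [n_i|i_even] := boolP (odd i).
  by rewrite U_oddE ?mulr0 // oddB ?(negbTE n_even) // -ltnS.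
by rewrite exprNn -signr_odd (negbTE i_even) mul1r.
Qed.

Lemma appellU_0 (R : comNzRingType) n : appellU n 0 = (U n)%:~R :> R.
Proof.
rewrite appellUE big_ord_recl big1 => [|i _].
  by rewrite expr0 bin0 subn0 !mul1r addr0.
by rewrite lift0 exprS mul0r mulr0 mul0r.
Qed.

Lemma appellU_1 (R : comNzRingType) n : (0 < n)%N -> ~~ odd n ->
  2 * appellU n 1 = (U n)%:~R :> R.
Proof.
move=> n_gt0 n_even; have := @appellU_rec R n 0.
rewrite add0r sub0r appellU_even // appellU_0 expr0n gtn_eqF //.
by move/eqP; rewrite subr_eq add0r => /eqP <-; rewrite mulr2n mulrDl mul1r.
Qed.

(** With T the shift by 1, [appellU_rec] reads (T^2 - T + 1) P(y) = (y + 1)^n, and T^6 - 1 = (T^2 -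
    T + 1)(T^4 + T^3 - T - 1). The second factor dictates the four signed powers. *)
Lemma appellU_6 (R : comNzRingType) n (y : R) :
  appellU n (y + 6) = appellU n y - (y + 1) ^+ n - (y + 2) ^+ n
                      + (y + 4) ^+ n + (y + 5) ^+ n.
Proof.
rewrite -[(y + 1) ^+ n]appellU_rec -[(y + 2) ^+ n]appellU_rec.
rewrite -[(y + 4) ^+ n]appellU_rec -[(y + 5) ^+ n]appellU_rec.
have E1 : y + 1 + 1 = y + 2 by ring. have E2 : y + 1 - 1 = y by ring.
have E3 : y + 2 + 1 = y + 3 by ring. have E4 : y + 2 - 1 = y + 1 by ring.
have E5 : y + 4 + 1 = y + 5 by ring. have E6 : y + 4 - 1 = y + 3 by ring.
have E7 : y + 5 + 1 = y + 6 by ring. have E8 : y + 5 - 1 = y + 4 by ring.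
rewrite E1 E2 E3 E4 E5 E6 E7 E8; ring.
Qed.

(** * Power sums over residue classes, and telescoping in steps of 6 *)

Definition powsum (R : pzRingType) (n m : nat) (P : pred nat) : R :=
  \sum_(1 <= x < m | P x) x%:R ^+ n.

Lemma powsum_recr (R : pzRingType) n m (P : pred nat) : (0 < m)%N ->
  powsum R n m.+1 P = powsum R n m P + (if P m then m%:R ^+ n else 0).
Proof.
by move=> m_gt0; rewrite /powsum big_mkcond big_nat_recr //= -big_mkcond.
Qed.

Lemma powsum_split (R : pzRingType) n m (P Q : pred nat) :
  powsum R n m P = powsum R n m (predI P Q) + powsum R n m (predI P (predC Q)).
Proof. by rewrite /powsum (bigID Q). Qed.

Lemma eq_powsum (R : pzRingType) n m (P Q : pred nat) :
  (forall x, (0 < x < m)%N -> P x = Q x) -> powsum R n m P = powsum R n m Q.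
Proof.
move=> eqPQ; rewrite /powsum big_nat_cond [RHS]big_nat_cond.
by apply: eq_bigl => x; case: (boolP (0 < x < m)%N) => //= /eqPQ ->.
Qed.

Definition modpred (d r : nat) : pred nat := fun x => (x %% d == r)%N.

Lemma powsumD (R : pzRingType) n m s (P : pred nat) : (0 < m)%N ->
  powsum R n (m + s) P = powsum R n m P
    + \sum_(j < s) (if P (m + j)%N then (m + j)%:R ^+ n else 0).
Proof.
move=> m_gt0; elim: s => [|s IHs]; first by rewrite addn0 big_ord0 addr0.
by rewrite addnS powsum_recr ?addn_gt0 ?m_gt0 // IHs big_ord_recr /= addrA.
Qed.

Lemma powsum_modpred6 (R : pzRingType) n q a r : (0 < a)%N ->
  powsum R n (6 * q + a + 6) (modpred 6 r) =
  powsum R n (6 * q + a) (modpred 6 r)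
  + \sum_(j < 6) (if ((a + j) %% 6 == r)%N
                  then ((6 * q + a)%:R + j%:R) ^+ n else 0).
Proof.
move=> a_gt0; rewrite powsumD ?addn_gt0 ?a_gt0 ?orbT //; congr (_ + _).
apply: eq_bigr => j _.
by rewrite /modpred -[(_ + a + j)%N]addnA mulnC modnMDl addnA natrD.
Qed.

(** Telescoping [appellU_6] from 1: when y is 1 mod 6, the points y + 1, y + 2, y + 4, y + 5 lie in
    the classes 2, 3, 5, 0. *)
Lemma appellU_1mod6 (R : comNzRingType) n q :
  appellU n (6 * q + 1)%:R =
  appellU n 1 + powsum R n (6 * q + 1) (modpred 6 5)
  + powsum R n (6 * q + 1) (modpred 6 0)
  - powsum R n (6 * q + 1) (modpred 6 2)
  - powsum R n (6 * q + 1) (modpred 6 3).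
Proof.
elim: q => [|q IHq]; first by rewrite /powsum !big_geq // !addr0 !subr0.
have -> : (6 * q.+1 + 1 = 6 * q + 1 + 6)%N by lia.
rewrite !powsum_modpred6 // !big_ord_recl !big_ord0 /= !addr0 !add0r.
by rewrite [(_ + 6)%:R]natrD appellU_6 IHq; ring.
Qed.

(** The same telescoping started at -1, where the classes met are 0, 1, 3, 4. *)
Lemma appellU_5mod6 (R : comNzRingType) n q : (0 < n)%N ->
  appellU n (6 * q + 5)%:R =
  appellU n (-1) + powsum R n (6 * q + 5) (modpred 6 3)
  + powsum R n (6 * q + 5) (modpred 6 4)
  - powsum R n (6 * q + 5) (modpred 6 0)
  - powsum R n (6 * q + 5) (modpred 6 1).
Proof.
move=> n_gt0; elim: q => [|q IHq].
  (* The base case is already one full step, from -1 to 5. It meets the power 0^n, absent from the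
     sums, which vanishes because n is positive. *)
  rewrite muln0 !(@powsumD R n 1 4 _ isT) !big_ord_recl !big_ord0 /=.
  rewrite /powsum !big_geq // !addr0 !add0r.
  rewrite (_ : 5%:R = -1 + 6 :> R); last by ring.
  rewrite appellU_6 (_ : -1 + 1 = 0 :> R); last by ring.
  rewrite (_ : -1 + 2 = 1 :> R); last by ring.
  rewrite (_ : -1 + 4 = 3 :> R); last by ring.
  rewrite (_ : -1 + 5 = 4 :> R); last by ring.
  rewrite expr0n gtn_eqF // mulr0n expr1n.
  by change (appellU n (-1) - 0 - 1 + 3 ^+ n + 4 ^+ n
             = appellU n (-1) + 3 ^+ n + 4 ^+ n - 0 - 1 :> R); ring.
have -> : (6 * q.+1 + 5 = 6 * q + 5 + 6)%N by lia.
rewrite !powsum_modpred6 // !big_ord_recl !big_ord0 /= !addr0 !add0r.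
by rewrite [(_ + 6)%:R]natrD appellU_6 IHq; ring.
Qed.

(** * Power sums in F_p: reflection, dilation, total sum *)

Lemma Fp_natr_eq0 p m : prime p -> (m%:R == 0 :> 'F_p) = (p %| m)%N.
Proof. by move=> p_pr; rewrite -(dvdn_pcharf (pchar_Fp p_pr)). Qed.

Lemma Fp_natrB p m : prime p -> (m <= p)%N -> (p - m)%:R = - m%:R :> 'F_p.
Proof.
by move=> p_pr le_mp; rewrite natrB // (pcharf0 (pchar_Fp p_pr)) sub0r.
Qed.

Lemma Fp_expf_pred p (x : 'F_p) : prime p -> x != 0 -> x ^+ p.-1 = 1.
Proof.
move=> p_pr nz_x; apply: (mulfI nz_x); rewrite -exprS prednK ?prime_gt0 //.
by have := finfield.expf_card x; rewrite card_Fp // mulr1.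
Qed.

Lemma powsum_rev p n (P : pred nat) : prime p -> ~~ odd n ->
  powsum 'F_p n p P = powsum 'F_p n p (fun x => P (p - x)%N).
Proof.
move=> p_pr n_even; rewrite /powsum big_nat_rev big_nat_cond [RHS]big_nat_cond.
have E x : (1 + p - x.+1 = p - x)%N by lia.
apply: eq_big => x; rewrite E // => /andP[/andP[_ /ltnW le_xp] _].
by rewrite Fp_natrB // exprNn -signr_odd (negbTE n_even) mul1r.
Qed.

Lemma powsum_mul p n d (P : pred nat) : prime p -> (1 < d)%N -> coprime p d ->
  powsum 'F_p n p (fun x => (d %| x)%N && P x) =
  d%:R ^+ n * powsum 'F_p n (p %/ d).+1 (fun y => P (d * y)%N).
Proof.
move=> p_pr d_gt1 cop_pd; have d_gt0 := ltnW d_gt1.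
have p_gt0 := prime_gt0 p_pr.
have ndv : ~~ (d %| p)%N.
  apply: contraL d_gt1 => /gcdn_idPr d_p.
  by rewrite -leqNgt -d_p (eqP cop_pd).
rewrite /powsum -[X in \sum_(1 <= x < X | _) _](prednK p_gt0) big_dvdn_mul //.
(* The two quotients agree because d does not divide p. *)
rewrite (_ : (p.-1 %/ d = p %/ d)%N); last first.
  by rewrite -[in RHS](prednK p_gt0) divnS // (prednK p_gt0) (negbTE ndv).
by rewrite mulr_sumr; apply: eq_bigr => y _; rewrite natrM exprMn.
Qed.

(** Multiplication by a nonzero g permutes F_p, so the sum equals g^n times itself; it vanishes once
    g^n differs from 1. *)
Lemma powsum_all p n : prime p -> (0 < n < p.-1)%N ->
  powsum 'F_p n p predT = 0.
Proof.
move=> p_pr /andP[n_gt0 lt_np].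
(* Such a g exists since X^n - 1 has at most n roots, fewer than the p - 1 nonzero elements. *)
have [g nz_g ne_g] : exists2 g : 'F_p, g != 0 & g ^+ n != 1.
  pose rs := [seq x <- enum 'F_p | x != 0].
  have: ~~ all (root ('X^n - 1)) rs.
    apply: contraL lt_np => /(max_poly_roots _) lt_rs.
    have := lt_rs; rewrite -size_poly_eq0 size_XnsubC // => /(_ isT).
    rewrite filter_uniq ?enum_uniq // => /(_ isT); rewrite ltnS -leqNgt.
    apply: leq_trans.
    rewrite /rs -rem_filter ?enum_uniq // size_rem ?mem_enum //.
    by rewrite -cardE card_Fp.
  case/allPn => x; rewrite mem_filter => /andP[nz_x _] nroot; exists x => //.
  by apply: contra nroot => /eqP xn1; rewrite rootE !hornerE xn1 subrr.
have sumE : powsum 'F_p n p predT = \sum_(x : 'F_p) x ^+ n.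
  rewrite /powsum.
  have -> : \sum_(1 <= x < p) x%:R ^+ n = \sum_(0 <= x < p) x%:R ^+ n :> 'F_p.
    by rewrite [RHS]big_ltn ?prime_gt0 // expr0n gtn_eqF // add0r.
  rewrite -[X in \sum_(0 <= x < X) _](Fp_cast p_pr) big_mkord.
  by apply: eq_bigr => x _; rewrite natr_Zp.
apply/eqP.
have: (g ^+ n - 1) * powsum 'F_p n p predT = 0; last first.
  by move/eqP; rewrite mulf_eq0 subr_eq0 (negbTE ne_g).
rewrite mulrBl mul1r sumE mulr_sumr.
under eq_bigr => x _ do rewrite -exprMn.
rewrite [X in _ - X](reindex_inj (mulfI nz_g)) subrr //.
Qed.
Lemma powsum_double p n i : prime p -> (2 < p)%N -> (i < 3)%N ->
  powsum 'F_p n p (modpred 6 (2 * i)) =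
  2 ^+ n * powsum 'F_p n (p %/ 2).+1 (modpred 3 i).
Proof.
move=> p_pr p_gt2 lt_i3.
have p_odd : odd p by case: (even_prime p_pr) => [|//]; lia.
rewrite (@eq_powsum _ _ _ _ (fun x => (2 %| x)%N && modpred 6 (2 * i) x)).
  rewrite powsum_mul ?coprimen2 //; congr (_ * _); apply: eq_powsum => x _.
  by rewrite /modpred; lia.
by move=> x _; rewrite /modpred; lia.
Qed.

(** The terms above p/2 are folded onto the lower half by x -> p - x, which preserves even
    powers. *)
Lemma powsum_halves p n (P : pred nat) : prime p -> (2 < p)%N -> ~~ odd n ->
  powsum 'F_p n p P = powsum 'F_p n (p %/ 2).+1 P
    + powsum 'F_p n (p %/ 2).+1 (fun x => P (p - x)%N).
Proof.
move=> p_pr p_gt2 n_even.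
have p_odd : odd p by case: (even_prime p_pr) => [|//]; lia.
have widen Q : powsum 'F_p n (p %/ 2).+1 Q
    = powsum 'F_p n p (fun x => Q x && (x < (p %/ 2).+1)%N).
  by rewrite /powsum (@big_nat_widen _ _ _ _ _ p) //; lia.
rewrite !widen [LHS](@powsum_split _ _ _ _ (fun x => (x < (p %/ 2).+1)%N)).
congr (_ + _); rewrite powsum_rev //; apply: eq_powsum => x lt_x /=.
by case: (P _) => //=; lia.
Qed.

(** * Linear relations between the class sums, and their solution in terms of [U n] *)

Lemma powsum_residues6 (R : pzRingType) n m :
  powsum R n m predT =
  powsum R n m (modpred 6 0) + powsum R n m (modpred 6 1)
  + powsum R n m (modpred 6 2) + powsum R n m (modpred 6 3)
  + powsum R n m (modpred 6 4) + powsum R n m (modpred 6 5).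
Proof.
rewrite /powsum !(big_mkcond (modpred _ _)) -!big_split /=.
apply: eq_bigr => x _; rewrite /modpred.
have: (x %% 6 < 6)%N by rewrite ltn_mod.
by case: (x %% 6)%N => [|[|[|[|[|[|]]]]]] //=; rewrite ?addr0 ?add0r.
Qed.

Lemma powsum_mod3 (R : pzRingType) n m i : (i < 3)%N ->
  powsum R n m (modpred 3 i) =
  powsum R n m (modpred 6 i) + powsum R n m (modpred 6 (3 + i)).
Proof.
move=> lt_i3; rewrite (@powsum_split _ _ _ _ (fun x => x %% 6 < 3)%N).
by congr (_ + _); apply: eq_powsum => x _; rewrite /modpred /=; lia.
Qed.

(** Reflection pairs the six sums [A i], leaving three unknowns. The vanishing total, doubling, and
    telescoping up to p supply three relations between them and [U n]. *)
Lemma powsum_modp_U p n : prime p -> (3 < p)%N -> ~~ odd n ->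
    (0 < n < p.-1)%N ->
  powsum 'F_p n p (modpred 6 (p %% 6)) =
    (1 + 2 ^+ n) * powsum 'F_p n p (modpred 3 (p %% 3)) /\
  2 * (1 + 2 * 2 ^+ n) * powsum 'F_p n p (modpred 3 (p %% 3)) =
    (legendre3 p)%:~R * (U n)%:~R.
Proof.
move=> p_pr p_gt3 n_even n_bnd; have [n_gt0 _] := andP n_bnd.
have p_gt2 := ltnW p_gt3; have p_gt0 := ltnW (ltnW p_gt2).
pose A i := powsum 'F_p n p (modpred 6 i).
pose H i := powsum 'F_p n (p %/ 2).+1 (modpred 3 i).
have nz2 : 2 != 0 :> 'F_p by rewrite Fp_natr_eq0 // gtnNdvd.
have A0 : A 0 = 2 ^+ n * H 0 by apply: (@powsum_double p n 0).
have A2 : A 2 = 2 ^+ n * H 1 by apply: (@powsum_double p n 1).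
have A4 : A 4 = 2 ^+ n * H 2 by apply: (@powsum_double p n 2).
have Arev i j : ((p + 6 - i) %% 6 = j)%N -> (i < 6)%N -> A i = A j.
  move=> def_j lt_i6; rewrite /A powsum_rev //; apply: eq_powsum => x lt_x.
  by rewrite /modpred; lia.
have Atot : A 0 + A 1 + A 2 + A 3 + A 4 + A 5 = 0.
  by rewrite -powsum_residues6 powsum_all.
have Pp : appellU n p%:R = (U n)%:~R :> 'F_p.
  by rewrite (pcharf0 (pchar_Fp p_pr)) appellU_0.
have P1 := @appellU_1 'F_p n n_gt0 n_even.
have p_mod6 : (p %% 6 = 1 \/ p %% 6 = 5)%N.
  have p_odd : odd p by case: (even_prime p_pr) => [|//]; lia.
  have p_n3 : ~~ (3 %| p)%N.
    by case/primeP: p_pr => _ pr; apply/negP => /pr/pred2P[] E; lia.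
  by lia.
have B3 r : powsum 'F_p n p (modpred 3 r) =
    H r + powsum 'F_p n (p %/ 2).+1 (fun x => modpred 3 r (p - x)%N).
  exact: powsum_halves.
case: p_mod6 => p_mod6; rewrite p_mod6.
- have p_mod3 : (p %% 3 = 1)%N by lia.
  rewrite p_mod3 /legendre3 p_mod3 /= mul1r.
  (* Since p is 1 mod 3, the reflection x -> p - x turns the class 1 mod 3 into the class 0. *)
  have B : A 1 + A 4 = H 1 + H 0.
    rewrite -[LHS](@powsum_mod3 _ _ _ 1) // B3; congr (_ + _).
    by apply: eq_powsum => x lt_x; rewrite /modpred; lia.
  have -> : powsum 'F_p n p (modpred 3 1) = A 1 + A 4 by rewrite powsum_mod3.
  have A01 : A 1 = A 0 by apply: Arev => //; lia.
  have A34 : A 4 = A 3 by apply: Arev => //; lia.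
  have A25 : A 5 = A 2 by apply: Arev => //; lia.
  have Ptel := @appellU_1mod6 'F_p n (p %/ 6).
  have p_eq : (6 * (p %/ 6) + 1 = p)%N by lia.
  rewrite p_eq Pp -/(A 0) -/(A 2) -/(A 3) -/(A 5) A25 in Ptel.
  rewrite -/(A 1).
  have S : A 0 + A 2 + A 3 = 0.
    apply: (mulfI nz2); rewrite mulr0 -Atot A01 A34 A25; ring.
  (* Multiplying [B] by 2^n turns the half-range sums [H 1], [H 0] into [A 2], [A 0], and [S] gives
     A 2 + A 0 = - A 3. *)
  have C : 2 ^+ n * (A 0 + A 3) = - A 3.
    by rewrite -A34 -{1}A01 B mulrDr -A2 -A0 A34 -[RHS]addr0 -S; ring.
  split; first by rewrite A01 A34 mulrDl mul1r C addrK.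
  rewrite A01 A34.
  have -> : 2 * (1 + 2 * 2 ^+ n) * (A 0 + A 3) =
    2 * (A 0 + A 3 + 2 * (2 ^+ n * (A 0 + A 3))) by ring.
  rewrite C.
  (* What remains is 2 (A 0 - A 3) = U_n. Telescoping gives U_n = P(1) + A 0 - A 3; it is doubled so
     that 2 P(1) = U_n can be used. *)
  apply: (addrI (- 2 * (U n)%:~R)); rewrite {1}Ptel.
  have -> : - 2 * (appellU n 1 + A 2 + A 0 - A 2 - A 3)
    = - (2 * appellU n 1) - 2 * (A 0 - A 3) by ring.
  by rewrite P1; ring.
(* Case p = 5 mod 6: reflection now exchanges i and 5 - i, and telescoping starts at -1, where P(-1)
   = P(1). The outcome 2 (A 2 - A 0) = U_n produces the sign of the Legendre symbol. *)
have p_mod3 : (p %% 3 = 2)%N by lia.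
rewrite p_mod3 /legendre3 p_mod3 /= mulN1r.
have B : A 2 + A 5 = H 2 + H 0.
  rewrite -[LHS](@powsum_mod3 _ _ _ 2) // B3; congr (_ + _).
  by apply: eq_powsum => x lt_x; rewrite /modpred; lia.
have -> : powsum 'F_p n p (modpred 3 2) = A 2 + A 5 by rewrite powsum_mod3.
have A05 : A 5 = A 0 by apply: Arev => //; lia.
have A14 : A 1 = A 4 by apply: Arev => //; lia.
have A23 : A 3 = A 2 by apply: Arev => //; lia.
have Ptel := @appellU_5mod6 'F_p n (p %/ 6) n_gt0.
have p_eq : (6 * (p %/ 6) + 5 = p)%N by lia.
rewrite p_eq Pp -/(A 0) -/(A 1) -/(A 3) -/(A 4) A14 A23 appellU_even // in Ptel.
rewrite -/(A 5).
have S : A 0 + A 2 + A 4 = 0.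
  apply: (mulfI nz2); rewrite mulr0 -Atot A05 A14 A23; ring.
have C : 2 ^+ n * (A 2 + A 0) = - A 2.
  by rewrite -{1}A05 B mulrDr -A4 -A0 -[RHS]addr0 -S; ring.
split; first by rewrite A05 mulrDl mul1r C; ring.
rewrite A05.
have -> : 2 * (1 + 2 * 2 ^+ n) * (A 2 + A 0) =
  2 * (A 2 + A 0 + 2 * (2 ^+ n * (A 2 + A 0))) by ring.
rewrite C.
apply: (addrI (2 * (U n)%:~R)); rewrite {1}Ptel.
have -> : 2 * (appellU n 1 + A 2 + A 4 - A 0 - A 4)
  = 2 * appellU n 1 + 2 * (A 2 - A 0) by ring.
by rewrite P1; ring.
Qed.

(** * Reduction modulo p of rationals with denominator prime to p *)

Definition reduces_to (p : nat) (a : rat) (u : 'F_p) : Prop :=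
  exists m d : int, [/\ d%:~R != 0 :> 'F_p, a = m%:~R / d%:~R
    & u = m%:~R / d%:~R].

Lemma Fp_intr_eq0 p (m : int) : prime p ->
  (m%:~R == 0 :> 'F_p) = (p%:Z %| m)%Z.
Proof.
move=> p_pr; rewrite -[RHS]/(p %| `|m|)%N -Fp_natr_eq0 //.
by case: m => m //=; rewrite NegzE rmorphN oppr_eq0.
Qed.

Lemma reduces_to_int p (m : int) : reduces_to (m%:~R) (m%:~R : 'F_p).
Proof. by exists m, 1; rewrite oner_neq0 !divr1. Qed.

Lemma reduces_to_nat p (m : nat) : reduces_to m%:R (m%:R : 'F_p).
Proof. exact: (reduces_to_int p m). Qed.

Lemma intr_Fp_neq0 p (d : int) : d%:~R != 0 :> 'F_p -> d%:~R != 0 :> rat.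
Proof. by apply: contraNneq => /eqP; rewrite intr_eq0 => /eqP ->. Qed.

Lemma reduces_toM p a b (u v : 'F_p) :
  reduces_to a u -> reduces_to b v -> reduces_to (a * b) (u * v).
Proof.
move=> [m [d [nz_d -> ->]]] [m' [d' [nz_d' -> ->]]].
exists (m * m'), (d * d'); rewrite !rmorphM /= mulf_neq0 //.
by rewrite !mulf_div.
Qed.

Lemma reduces_toD p a b (u v : 'F_p) :
  reduces_to a u -> reduces_to b v -> reduces_to (a + b) (u + v).
Proof.
move=> [m [d [nz_d -> ->]]] [m' [d' [nz_d' -> ->]]].
exists (m * d' + m' * d), (d * d'); rewrite !(rmorphM, rmorphD) /= mulf_neq0 //.
by split=> //; rewrite addf_div //; apply: intr_Fp_neq0; eassumption.
Qed.

Lemma reduces_toV p a (u : 'F_p) :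
  u != 0 -> reduces_to a u -> reduces_to a^-1 u^-1.
Proof.
move=> nz_u [m [d [nz_d -> def_u]]]; exists d, m; rewrite def_u !invf_div.
by split=> //; apply: contraNneq nz_u => m0; rewrite def_u m0 mul0r.
Qed.

Lemma reduces_toX p a (u : 'F_p) k :
  reduces_to a u -> reduces_to (a ^+ k) (u ^+ k).
Proof.
move=> a_u; elim: k => [|k IHk]; first exact: (reduces_to_int p 1).
by rewrite !exprS; apply: reduces_toM.
Qed.

Lemma reduces_to_sum p m n (P : pred nat) (F : nat -> rat) (G : nat -> 'F_p) :
    (forall x, (m <= x < n)%N -> reduces_to (F x) (G x)) ->
  reduces_to (\sum_(m <= x < n | P x) F x) (\sum_(m <= x < n | P x) G x).
Proof.
move=> FG; rewrite !(big_nat_cond _ _ _ _ P).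
apply: (big_ind2 (fun a u => reduces_to a u)) => [|a u b v|x /andP[/FG]] //.
  exact: reduces_to_nat 0.
exact: reduces_toD.
Qed.

Lemma numq_frac (a : rat) (m d : int) :
  d%:~R != 0 :> rat -> a = m%:~R / d%:~R -> numq a * d = m * denq a.
Proof.
move=> nz_d def_a; apply: (@intr_inj rat).
by rewrite !rmorphM /= numqE mulrAC def_a divfK.
Qed.

(** Fractions witnessing [reduces_to] need not be in lowest terms, which makes it stable under field
    operations; here cross-multiplication by [numq_frac] passes back to [numq] and [denq]. *)
Lemma ratcong_reduces_to p a b (u : 'F_p) : prime p ->
  reduces_to a u -> reduces_to b u -> ratcong p a b.
Proof.
move=> p_pr a_u b_u.
have cop c (v : 'F_p) : reduces_to c v -> coprimez p%:Z (denq c).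
  move=> [m [d [nz_d def_c _]]]; have nz_dQ := intr_Fp_neq0 nz_d.
  rewrite /coprimez /gcdz -[_ == _]/(coprime p `|denq c|) prime_coprime //.
  apply: contraNN nz_d => p_c; rewrite Fp_intr_eq0 //.
  (* The reduced denominator divides d, by Gauss applied to numq c * d = m * denq c. *)
  apply: (dvdn_trans p_c); rewrite -(Gauss_dvdr _ (n := `|numq c|)).
    have /(congr1 absz) := numq_frac nz_dQ def_c.
    rewrite !abszM => ->.
    exact: dvdn_mull.
  by rewrite coprime_sym; apply: coprime_num_den.
split; [exact: cop a_u | exact: cop b_u |].
have: reduces_to (a - b) (u - u).
  apply: reduces_toD a_u _; rewrite -mulN1r -[- u]mulN1r.
  exact: reduces_toM (reduces_to_int p (-1)) b_u.
(* As a - b reduces to 0, p divides m, hence numq (a - b) * d; but p does not divide d. *)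
rewrite subrr => -[m [d [nz_d def_ab /esym/eqP]]].
rewrite mulf_eq0 invr_eq0 (negbTE nz_d) orbF Fp_intr_eq0 // => p_m.
have /(congr1 absz) := numq_frac (intr_Fp_neq0 nz_d) def_ab.
rewrite !abszM => def_num.
have: (p %| `|numq (a - b)| * `|d|)%N by rewrite def_num dvdn_mulr.
rewrite Euclid_dvdM // => /orP[//|p_d].
by case/negP: nz_d; rewrite Fp_intr_eq0.
Qed.

(** * Sums of inverse powers as power sums in F_p *)

Lemma reduces_to_inv_pow_sum p k m (P : pred nat) :
    prime p -> (k <= p.-1)%N -> (m <= p)%N ->
  reduces_to (\sum_(1 <= x < m | P x) 1 / x%:R ^+ k)
             (powsum 'F_p (p.-1 - k) m P).
Proof.
move=> p_pr le_kp le_mp; apply: reduces_to_sum => x /andP[x_gt0 lt_xm].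
have nz_x : x%:R != 0 :> 'F_p.
  by rewrite Fp_natr_eq0 // gtnNdvd // (leq_trans lt_xm).
have -> : x%:R ^+ (p.-1 - k) = (x%:R ^+ k)^-1 :> 'F_p.
  apply: (mulIf (expf_neq0 k nz_x)).
  rewrite -exprD subnK // mulVf ?expf_neq0 //.
  exact: Fp_expf_pred.
rewrite div1r; apply: reduces_toV; first exact: expf_neq0.
exact/reduces_toX/reduces_to_nat.
Qed.

(** The reflection x -> p - x carries the class of p mod d to the multiples of d. Writing these as d
    y extracts d^n, and d^k d^n = d^(p-1) = 1. *)
Lemma powsum_divn p k n d : prime p -> (1 < d)%N -> coprime p d -> ~~ odd n ->
    (k + n)%N = p.-1 ->
  d%:R ^+ k * powsum 'F_p n p (modpred d (p %% d)) =
  powsum 'F_p n (p %/ d).+1 predT.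
Proof.
move=> p_pr d_gt1 cop_pd n_even kn.
rewrite powsum_rev // (@eq_powsum _ _ _ _ (fun x => (d %| x)%N && predT x)).
  rewrite powsum_mul // mulrA -exprD kn Fp_expf_pred ?mul1r //.
  by rewrite Fp_natr_eq0 // -prime_coprime.
move=> x /andP[_ /ltnW le_xp]; rewrite /modpred andbT eq_sym.
by rewrite eqn_mod_dvd ?leq_subr // subKn.
Qed.

Lemma dvdz_sub_modpred d p x :
  (d%:Z %| x%:Z - p%:Z)%Z = modpred d (p %% d) x.
Proof. by rewrite -eqz_mod_dvd !modz_nat. Qed.

(* The hypothesis coprime p (2 ^ (k - 1) + 1) says that the denominator
   4 (2^(k-1) + 1) is coprime to p, without which the last member of each chain
   is not a quotient of the kind that congruences mod p are defined for
   (for p = 11, k = 6, where 11 divides both 2^5 + 1 and U_4, cancelling the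
   common factor 11 gives a false congruence). *)
Theorem theorem3p3 (p k : nat) (p_prime : prime p) (p_gt3 : (3 < p)%N)
    (k_even : ~~ odd k) (k_ge2 : (2 <= k)%N) (k_le : (k <= p - 3)%N) :
  (ratcong p
     (\sum_(1 <= x < (p %/ 6).+1) 1 / x%:R ^+ k)
     (6 ^+ k * \sum_(1 <= x < p | (6 %| x%:Z - p%:Z)%Z) 1 / x%:R ^+ k)
   /\
   (coprime p (2 ^ (k - 1) + 1) ->
    ratcong p
     (6 ^+ k * \sum_(1 <= x < p | (6 %| x%:Z - p%:Z)%Z) 1 / x%:R ^+ k)
     (6 ^+ k * (2 ^+ k + 1) / (4 * (2 ^+ (k - 1) + 1))
        * (legendre3 p)%:~R * (U (p - 1 - k))%:~R)))
  /\
  (ratcong p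
     (\sum_(1 <= x < (p %/ 3).+1) 1 / x%:R ^+ k)
     (3 ^+ k * \sum_(1 <= x < p | (3 %| x%:Z - p%:Z)%Z) 1 / x%:R ^+ k)
   /\
   (coprime p (2 ^ (k - 1) + 1) ->
    ratcong p
     (3 ^+ k * \sum_(1 <= x < p | (3 %| x%:Z - p%:Z)%Z) 1 / x%:R ^+ k)
     (6 ^+ k / (4 * (2 ^+ (k - 1) + 1))
        * (legendre3 p)%:~R * (U (p - 1 - k))%:~R))).
Proof.
pose n := (p.-1 - k)%N; have nE : (p - 1 - k)%N = n by rewrite /n subn1.
have p_odd : odd p by case: (even_prime p_prime) => [|//]; lia.
have n_even : ~~ odd n by lia.
have kn : (k + n = p.-1)%N by lia.
have n_bnd : (0 < n < p.-1)%N by lia.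
have cop2 : coprime p 2 by rewrite coprimen2.
have cop3 : coprime p 3 by rewrite prime_coprime // gtnNdvd.
have cop6 : coprime p 6 by rewrite -[6%N]/(2 * 3)%N coprimeMr cop2 cop3.
have nz2 : 2 != 0 :> 'F_p by rewrite Fp_natr_eq0 // -prime_coprime.
have two_kn : 2 ^+ k * 2 ^+ n = 1 :> 'F_p.
  by rewrite -exprD kn Fp_expf_pred.
have E6 : 6 ^+ k = 2 ^+ k * 3 ^+ k :> 'F_p by rewrite -exprMn -natrM.
have [A_eq B_eq] := powsum_modp_U p_prime p_gt3 n_even n_bnd.
have kle : (k <= p.-1)%N by lia.
have red_floor d : (1 < d)%N -> reduces_to
    (\sum_(1 <= x < (p %/ d).+1) 1 / x%:R ^+ k)
    (powsum 'F_p n (p %/ d).+1 predT).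
  move=> d_gt1; apply: reduces_to_inv_pow_sum => //.
  by rewrite ltn_Pdiv // prime_gt0.
have red_mod d : reduces_to
    (\sum_(1 <= x < p | (d%:Z %| x%:Z - p%:Z)%Z) 1 / x%:R ^+ k)
    (powsum 'F_p n p (modpred d (p %% d))).
  under eq_bigl => x do rewrite dvdz_sub_modpred.
  exact: reduces_to_inv_pow_sum.
have red_natX d e : reduces_to (d%:R ^+ e) (d%:R ^+ e : 'F_p).
  exact/reduces_toX/reduces_to_nat.
have red_dmod d : coprime p d -> (1 < d)%N -> reduces_to
    (d%:R ^+ k * \sum_(1 <= x < p | (d%:Z %| x%:Z - p%:Z)%Z) 1 / x%:R ^+ k)
    (powsum 'F_p n (p %/ d).+1 predT).
  move=> cop_d d_gt1.
  rewrite -(powsum_divn p_prime d_gt1 cop_d n_even kn).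
  exact: reduces_toM.
pose D : 'F_p := 4 * (2 ^+ (k - 1) + 1).
pose B := powsum 'F_p n p (modpred 3 (p %% 3)).
have red_D : reduces_to (4 * (2 ^+ (k - 1) + 1)) D.
  apply: reduces_toM; first exact: (reduces_to_nat p 4).
  by apply: reduces_toD (red_natX 2 _) _; apply: (reduces_to_nat p 1).
(* From 2^k 2^n = 1 and 2^k = 2 * 2^(k-1) one gets D = 2 * 2^k (1 + 2 * 2^n), which matches the
   coefficient in [B_eq]. *)
have BD : D * (3 ^+ k * B) = 6 ^+ k * ((legendre3 p)%:~R * (U n)%:~R).
  have alg (R : comNzRingType) (a b c e x : R) : a * c = 1 -> a = 2 * e ->
      4 * (e + 1) * (b * x) = a * b * (2 * (1 + 2 * c) * x).
    move=> ac def_a; transitivity (2 * b * x * (a + 2 * (a * c))); last by ring.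
    by rewrite ac def_a; ring.
  rewrite -B_eq E6; apply: alg two_kn _.
  by rewrite -exprS subn1 prednK // ltnW.
have nzD : coprime p (2 ^ (k - 1) + 1) -> D != 0.
  move=> copD; rewrite (_ : D = (4 * (2 ^ (k - 1) + 1))%:R).
    rewrite Fp_natr_eq0 // -prime_coprime // coprimeMr copD andbT.
    by rewrite -[4%N]/(2 * 2)%N coprimeMr cop2.
  by rewrite natrM natrD natrX.
have red_U : reduces_to ((legendre3 p)%:~R * (U n)%:~R)
    ((legendre3 p)%:~R * (U n)%:~R : 'F_p).
  exact: reduces_toM (reduces_to_int _ _) (reduces_to_int _ _).
have B_D : D != 0 ->
    3 ^+ k * B = 6 ^+ k / D * ((legendre3 p)%:~R * (U n)%:~R).
  by move=> nz_D; rewrite mulrAC -BD mulrAC mulfV // mul1r.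
rewrite nE; split; split.
- exact: ratcong_reduces_to (red_floor 6 isT) (red_dmod 6 cop6 isT).
- move=> /nzD nz_D.
  apply: (ratcong_reduces_to p_prime (reduces_toM (red_natX 6 k) (red_mod 6))).
  (* By [A_eq] the left side is 2^k 3^k (1 + 2^n) B, and 2^k (1 + 2^n) = 2^k + 1; this reduces the
     claim to [B_D]. *)
  have -> : 6 ^+ k * powsum 'F_p n p (modpred 6 (p %% 6)) =
      6 ^+ k * (2 ^+ k + 1) / D * ((legendre3 p)%:~R * (U n)%:~R).
    have alg (R : comNzRingType) (a b c x : R) :
        a * c = 1 -> a * b * ((1 + c) * x) = (a + 1) * (b * x).
      by move=> ac; rewrite -[in RHS]ac; ring.
    by rewrite A_eq {1}E6 alg // B_D // !mulrA [_ * 6 ^+ k]mulrC.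
  rewrite -mulrA; apply: reduces_toM red_U.
  apply: reduces_toM (reduces_toV nz_D red_D).
  apply: reduces_toM => //; apply: reduces_toD (red_natX 2 k) _.
  exact: (reduces_to_nat p 1).
- exact: ratcong_reduces_to (red_floor 3 isT) (red_dmod 3 cop3 isT).
move=> /nzD nz_D.
apply: (ratcong_reduces_to p_prime (reduces_toM (red_natX 3 k) (red_mod 3))).
rewrite [3 ^+ k * _]B_D // -mulrA; apply: reduces_toM red_U.
exact: reduces_toM (red_natX 6 k) (reduces_toV nz_D red_D).
Qed.
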